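(* Let $\{\mathcal A^{(\epsilon)}\}$ be a family of randomized algorithms such that $\mathcal A^{(\epsilon)}$ is $(\epsilon,0)_{2D}$-node DP for each $\epsilon$. Then the algorithm which, on input $G\in\mathcal G_n$, outputs the pair $$\left(\hat L_{\epsilon_1,\delta_1}(G),\ \mathcal A^{(\epsilon_2'(G))}(T_D(G))\right),\qquad \epsilon_2'(G)=\frac{\epsilon_2}{\hat L_{\epsilon_1,\delta_1}(G)},$$ satisfies $(\epsilon_1+\epsilon_2,\ e^{\epsilon_1}\delta_1)$-node DP.
   Context: $\mathcal G_n$ is the set of unweighted undirected graphs on $[n]$; $\mathcal G_{n,D}$ is the subset with maximum degree at most $D$. $d_{node}(G,G')$ is the minimum number of nodes that must be rewired (row/column of the adjacency matrix changed) to turn $G'$ into $G$; $G\sim_{node}G'$ if $d_{node}(G,G')\le1$. A randomized algorithm $\mathcal A$ on $\mathcal G_n$ is $(\epsilon,\delta)$-node DP if $\mathbb P(\mathcal A(G)\in S)\le e^\epsilon\mathbb P(\mathcal A(G')\in S)+\delta$ for all $G\sim_{node}G'$ in $\mathcal G_n$ and measurable $S$. It is $(\epsilon,\delta)_{2D}$-node DP if this inequality holds for all $G\sim_{node}G'$ with $G,G'\in\mathcal G_{n,2D}$. Degree truncation: for $G\in\mathcal G_n$ with $a_{uv}=1$ if $(u,v)$ is an edge and $0$ otherwise, consider the linear program in variables $x_u$ ($u\in[n]$) and $w_{uv}=w_{vu}$ (unordered pairs): minimize $\sum_ux_u$ subject to $x_u\ge0$, $w_{uv}\ge0$, $a_{uv}\ge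 w_{uv}\ge a_{uv}-x_u-x_v$ for all $u,v$, and $\sum_{v\ne u}w_{uv}\le D$ for all $u$. Let $(x^*,w^* )$ be the optimal solution (chosen by a fixed deterministic rule). $T_D(G)$ is obtained from $G$ by removing every edge $(u,v)$ with $x_u^*\ge\frac14$ or $x_v^*\ge\frac14$; this maps $\mathcal G_n$ to $\mathcal G_{n,2D}$. Let $d_{T_D}(G)=4\sum_ux_u^*$, and for $\delta\in(0,1)$ $$\hat L_{\epsilon,\delta}(G)=\max\left\{\tfrac12,\ 5+2d_{T_D}(G)+\mathrm{Lap}\left(\tfrac8\epsilon\right)+\tfrac{8\log(1/\delta)}{\epsilon}\right\},$$ where $\mathrm{Lap}(b)$ is a Laplace random variable with scale $b$. The Laplace noise is independent of the internal randomness of the algorithms $\mathcal A^{(\epsilon)}$. *)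

(* Defs.v *)
From HB Require Import structures.
From mathcomp Require Import all_boot all_order all_algebra.
From mathcomp Require Import all_classical all_reals all_analysis.

Set Implicit Arguments.
Unset Strict Implicit.
Unset Printing Implicit Defensive.

Import Order.TTheory GRing.Theory Num.Theory.
Import numFieldNormedType.Exports.

Local Open Scope classical_set_scope.
Local Open Scope ring_scope.

Definition is_adjacency (n : nat) (A : 'M[bool]_n) : bool :=
  (A^T == A) && [forall u, ~~ A u u].

Record graph (n : nat) : Type :=
  Graph { adj : 'M[bool]_n; adjP : is_adjacency adj }.

HB.instance Definition _ n := [isSub for @adj n].

Definition degree (n : nat) (G : graph n) (u : 'I_n) : nat :=
  #|[set v | adj G u v]%SET|.

Definition max_degree (n : nat) (G : graph n) : nat :=
  (\max_(u < n) degree G u)%N.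

(* Changing the rows and columns indexed by S suffices to turn G' into G. *)
Definition rewires (n : nat) (G G' : graph n) (S : {set 'I_n}) : bool :=
  [forall u, forall v, (u \notin S) ==> (v \notin S) ==> (adj G u v == adj G' u v)].

(* The full vertex set always satisfies [rewires], so this is a minimum over
   a nonempty family. *)
Definition d_node (n : nat) (G G' : graph n) : nat :=
  #|[arg min_(S < [set: 'I_n]%SET | rewires G G' S) #|S| ]|.

Definition node_neighbors (n : nat) (G G' : graph n) : Prop :=
  (d_node G G' <= 1)%N.

(* A randomized algorithm is a family of random elements [M G] of the output
   space.  Only the laws of the [M G] matter, so one probability space can
   serve all inputs. *)
Definition node_DP_on (n : nat) (Q : graph n -> Prop) (R : realType)
    (d : measure_display) (Omega : measurableType d) (P : probability Omega R)
    (d' : measure_display) (T : measurableType d')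
    (M : graph n -> Omega -> T) (eps delta : R) : Prop :=
  forall G G' : graph n, Q G -> Q G' -> node_neighbors G G' ->
  forall S : set T, measurable S ->
  (P (M G @^-1` S) <= (expR eps)%:E * P (M G' @^-1` S) + delta%:E)%E.

Definition node_DP (n : nat) (R : realType)
    (d : measure_display) (Omega : measurableType d) (P : probability Omega R)
    (d' : measure_display) (T : measurableType d')
    (M : graph n -> Omega -> T) (eps delta : R) : Prop :=
  node_DP_on (fun=> True) P M eps delta.

Definition node_DP_2D (n D : nat) (R : realType)
    (d : measure_display) (Omega : measurableType d) (P : probability Omega R)
    (d' : measure_display) (T : measurableType d')
    (M : graph n -> Omega -> T) (eps delta : R) : Prop :=
  node_DP_on (fun G => (max_degree G <= 2 * D)%N) P M eps delta.

Definition lp_feasible (n D : nat) (R : realType) (G : graph n)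
    (x : 'I_n -> R) (w : 'I_n -> 'I_n -> R) : Prop :=
  [/\ forall u, 0 <= x u,
      forall u v, w u v = w v u,
      forall u v, 0 <= w u v,
      forall u v, (adj G u v)%:R - x u - x v <= w u v <= (adj G u v)%:R
    & forall u, \sum_(v < n | v != u) w u v <= D%:R].

Definition lp_optimal (n D : nat) (R : realType) (G : graph n)
    (xw : ('I_n -> R) * ('I_n -> 'I_n -> R)) : Prop :=
  lp_feasible D G xw.1 xw.2 /\
  forall x w, lp_feasible D G x w -> \sum_(u < n) xw.1 u <= \sum_(u < n) x u.

Definition truncate_adj (n : nat) (R : realType) (x : 'I_n -> R) (G : graph n) :
    'M[bool]_n :=
  \matrix_(u, v) (adj G u v && ~~ ((4^-1 <= x u) || (4^-1 <= x v))).

Lemma truncate_adjP (n : nat) (R : realType) (x : 'I_n -> R) (G : graph n) :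
  is_adjacency (truncate_adj x G).
Proof.
have /andP[/eqP symG /forallP irrG] := adjP G.
apply/andP; split; last by apply/forallP => u; rewrite mxE (negbTE (irrG u)).
by apply/eqP/matrixP => u v; rewrite !mxE -[in RHS]symG mxE orbC.
Qed.

(* In [truncate], [trunc_dist] and [L_hat], x is the x-part of the optimal LP
   solution at G. *)
Definition truncate (n : nat) (R : realType) (x : 'I_n -> R) (G : graph n) :
    graph n := Graph (truncate_adjP x G).

Definition trunc_dist (n : nat) (R : realType) (x : 'I_n -> R) : R :=
  4 * \sum_(u < n) x u.

(* z is the realised value of the Laplace noise. *)
Definition L_hat (n : nat) (R : realType) (eps delta : R) (x : 'I_n -> R) (z : R) : R :=
  Num.max (2^-1) (5 + 2 * trunc_dist x + z + 8 * ln (delta^-1) / eps).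

Definition laplace_pdf (R : realType) (b t : R) : R :=
  expR (- (`|t| / b)) / (2 * b).

Definition has_laplace_law (R : realType) (d : measure_display)
    (Omega : measurableType d) (P : probability Omega R)
    (Z : {RV P >-> R}) (b : R) : Prop :=
  forall B : set R, measurable B ->
  distribution P Z B = (\int[lebesgue_measure]_(t in B) (laplace_pdf b t)%:E)%E.

Definition independent_RVs (R : realType) (d : measure_display)
    (Omega : measurableType d) (P : probability Omega R)
    (d1 d2 : measure_display) (T1 : measurableType d1) (T2 : measurableType d2)
    (X : {RV P >-> T1}) (Y : {RV P >-> T2}) : Prop :=
  forall (B : set T1) (C : set T2), measurable B -> measurable C ->
  P (X @^-1` B `&` Y @^-1` C) = (P (X @^-1` B) * P (Y @^-1` C))%E.

(* Main.v *)
Require Import Defs.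
From HB Require Import structures.
From mathcomp Require Import all_boot all_order all_algebra.
From mathcomp Require Import all_classical all_reals all_analysis.
From mathcomp Require Import measurable_realfun lra.

(** Three facts drive the result.

    Rewiring one node moves the optimal value of the linear program by at most
    1: a solution for one graph becomes feasible for the other once the rewired
    node gets x = 1 and its incident weights are set to 0
    ([lp_value_lipschitz]).  So [trunc_dist] moves by at most 4, the centre of
    the Laplace noise in [L_hat] by at most 8, and noise of scale 8 / eps1 makes
    the first output eps1-private ([laplace_expectation_shift]).

    The truncations of neighbouring graphs G and G' are joined by at most
    5 + 2 * trunc_dist x single-node rewirings that never leave the graphs of
    degree at most 2D ([truncation_rewiring_path]).  Staying in that class is
    the delicate point: two graphs of small degree which differ on k nodes are
    in general not joined by k rewirings through graphs of small degree.  For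
    truncations it works because the path first deletes the edges at the heavy
    nodes of G', then rewires the node where G and G' differ, and finally
    adds the edges of the truncation of G' at the heavy nodes of G, so that every
    intermediate graph is a subgraph of one of the two truncations.  Group privacy along this path
    costs the algorithm with parameter eps2 / L a factor of at most exp(eps2)
    whenever L is at least the length of the path.

    The remaining event, in which L is too small, forces the noise below
    -(8 / eps1) ln(1 / delta1), which has probability at most delta1
    ([laplace_lower_tail]).

    To combine these, the noise and the seed are independent, so the probability
    of an output event is the integral over the noise value t of a conditional
    probability ([independent_joint_law]).  For each t, the inputs G and G' are
    compared at the same realised L, which gives the factor exp(eps2) up to the
    indicator of the bad event; integrating and shifting the noise then gives
    the factor exp(eps1). *)

Set Implicit Arguments.
Unset Strict Implicit.
Unset Printing Implicit Defensive.

Import Order.TTheory GRing.Theory Num.Theory.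
Import numFieldNormedType.Exports.

Local Open Scope classical_set_scope.
Local Open Scope ring_scope.

(** * Node distance and pruned graphs *)

Lemma node_neighborsP n (G G' : graph n) :
  node_neighbors G G' <->
  exists2 S : {set 'I_n}, (#|S| <= 1)%N & rewires G G' S.
Proof.
have full : rewires G G' [set: 'I_n]%SET.
  by apply/forallP => u; apply/forallP => v; rewrite !inE.
rewrite /node_neighbors /d_node; split.
  by case: arg_minnP => // S rS _ S1; exists S.
case: arg_minnP => // S rS minS [S' S'1 rS']; exact: leq_trans (minS _ rS') S'1.
Qed.

Lemma rewires_sym n (G G' : graph n) (S : {set 'I_n}) :
  rewires G G' S = rewires G' G S.
Proof. by apply: eq_forallb => u; apply: eq_forallb => v; rewrite eq_sym. Qed.

Lemma node_neighbors_sym n (G G' : graph n) :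
  node_neighbors G G' -> node_neighbors G' G.
Proof.
move=> /node_neighborsP[S S1 rS]; apply/node_neighborsP.
by exists S => //; rewrite rewires_sym.
Qed.

(** Pruning deletes the edges at V but keeps its nodes, so that all graphs live
    on the same vertex set. *)
Definition prune_adj n (V : {set 'I_n}) (G : graph n) : 'M[bool]_n :=
  \matrix_(u, v) [&& adj G u v, u \notin V & v \notin V].

Lemma prune_adjP n (V : {set 'I_n}) (G : graph n) :
  is_adjacency (prune_adj V G).
Proof.
have /andP[/eqP symG /forallP irrG] := adjP G.
apply/andP; split; last by apply/forallP => u; rewrite mxE (negbTE (irrG u)).
by apply/eqP/matrixP => u v; rewrite !mxE -[in RHS]symG mxE; congr (_ && _); exact: andbC.
Qed.

Definition prune n (V : {set 'I_n}) (G : graph n) : graph n :=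
  Graph (prune_adjP V G).

(** The nodes at which the truncation deletes every edge. *)
Definition heavy n (R : realType) (x : 'I_n -> R) : {set 'I_n} :=
  [set u | 4^-1 <= x u]%SET.

Lemma truncate_prune n (R : realType) (x : 'I_n -> R) (G : graph n) :
  truncate x G = prune (heavy x) G.
Proof.
by apply: val_inj; apply/matrixP => u v; rewrite !mxE !inE negb_or.
Qed.

Lemma prune_neighbors n (V W : {set 'I_n}) (G : graph n) :
  (#|W| <= 1)%N -> node_neighbors (prune V G) (prune (V :|: W) G).
Proof.
move=> W1; apply/node_neighborsP; exists W => //.
apply/forallP => u; apply/forallP => v; apply/implyP => uW; apply/implyP => vW.
by rewrite !mxE !inE (negbTE uW) (negbTE vW) !orbF.
Qed.

Lemma neighbors_prune n (V : {set 'I_n}) (G G' : graph n) :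
  node_neighbors G G' -> node_neighbors (prune V G) (prune V G').
Proof.
move=> /node_neighborsP[S S1 /forallP rS]; apply/node_neighborsP; exists S => //.
apply/forallP => u; apply/forallP => v; apply/implyP => uS; apply/implyP => vS.
have /forallP/(_ v) := rS u; rewrite uS vS !mxE => /eqP ->; exact: eqxx.
Qed.

Lemma max_degree_prune n (V W : {set 'I_n}) (G : graph n) :
  (max_degree (prune (V :|: W) G) <= max_degree (prune V G))%N.
Proof.
apply/bigmax_leqP => u _; apply: leq_trans (leq_bigmax u).
apply/subset_leq_card/fintype.subsetP => v.
by rewrite !inE !mxE !inE !negb_or => /and3P[-> /andP[-> _] /andP[-> _]].
Qed.

(** * Rewiring paths inside a class of graphs *)

(** Every graph on the path, not only its two ends, has to satisfy Q: privacy
    restricted to Q can only be invoked between graphs of Q. *)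
Inductive rewiring_path n (Q : graph n -> Prop) : nat -> graph n -> graph n -> Prop :=
| RewiringNil G : rewiring_path Q 0 G G
| RewiringStep k G K H : Q G -> Q K -> node_neighbors G K ->
    rewiring_path Q k K H -> rewiring_path Q k.+1 G H.

Lemma rewiring_path_cat n (Q : graph n -> Prop) k m G K H :
  rewiring_path Q k G K -> rewiring_path Q m K H ->
  rewiring_path Q (k + m) G H.
Proof.
elim=> // {}k {}G L {}K QG QL GL _ IH KH.
by rewrite addSn; apply: RewiringStep GL (IH KH).
Qed.

Lemma rewiring_path_sym n (Q : graph n -> Prop) k G H :
  rewiring_path Q k G H -> rewiring_path Q k H G.
Proof.
elim=> [K|{}k {}G K {}H QG QK GK _ IH]; first exact: RewiringNil.
rewrite -addn1; apply: rewiring_path_cat IH _.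
exact: RewiringStep (node_neighbors_sym GK) (RewiringNil _ _).
Qed.

(** The nodes of W are emptied one at a time; edges only disappear, so the
    degree bound of the first graph holds all along. *)
Lemma prune_rewiring_path n m (V W : {set 'I_n}) (G : graph n) :
  (max_degree (prune V G) <= m)%N ->
  rewiring_path (fun H => (max_degree H <= m)%N) #|W|
    (prune V G) (prune (V :|: W) G).
Proof.
move: {2}#|W| (erefl #|W|) => k; elim: k V W => [|k IH] V W cW degV.
  move/eqP: cW; rewrite cards_eq0 => /eqP ->.
  by rewrite cards0 finset.setU0; exact: RewiringNil.
have [w wW] : exists w, w \in W by apply/set0Pn; rewrite -card_gt0 cW.
rewrite -(finset.setD1K wW) finset.setUA cardsU1 !inE eqxx /= add1n.
have degVw : (max_degree (prune (V :|: [set w]%SET) G) <= m)%N.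
  exact: leq_trans (max_degree_prune _ _ _) degV.
apply: (RewiringStep degV degVw); first by apply: prune_neighbors; rewrite cards1.
by apply: IH degVw; move: cW; rewrite (cardsD1 w W) wW add1n => -[].
Qed.

(** The path runs through G and G' pruned at both V and V', which are neighbours
    of one another.  Passing from one to the other is the only step where edges
    may appear and disappear at once. *)
Lemma pruned_neighbors_rewiring_path n m (V V' : {set 'I_n}) (G G' : graph n) :
  node_neighbors G G' ->
  (max_degree (prune V G) <= m)%N -> (max_degree (prune V' G') <= m)%N ->
  rewiring_path (fun H => (max_degree H <= m)%N) (#|V'| + (#|V| + 1))
    (prune V G) (prune V' G').
Proof.
move=> GG' degV degV'; apply: (rewiring_path_cat (prune_rewiring_path V' degV)).
rewrite addn1; apply: RewiringStep (neighbors_prune (V :|: V') GG') _.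
- exact: leq_trans (max_degree_prune _ _ _) degV.
- by rewrite finset.setUC; exact: leq_trans (max_degree_prune _ _ _) degV'.
- by rewrite finset.setUC; apply/rewiring_path_sym/prune_rewiring_path.
Qed.

(** * The linear program *)

(** An edge that survives has both ends below 1/4, hence weight above 1/2, and
    the weights at a node add up to at most D. *)
Lemma max_degree_truncate n D (R : realType) (G : graph n)
    (x : 'I_n -> R) (w : 'I_n -> 'I_n -> R) :
  lp_feasible D G x w -> (max_degree (truncate x G) <= 2 * D)%N.
Proof.
move=> [x0 _ w0 wb wD]; apply/bigmax_leqP => u _.
rewrite -(ler_nat R) natrM -ler_pdivrMl//; apply: le_trans (wD u).
rewrite /degree -sum1_card natr_sum mulr_sumr.
rewrite big_mkcond [leRHS]big_mkcond /=; apply: ler_sum => v _.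
rewrite inE mxE; case: ifPn => [/andP[uv /norP[xu xv]]|_]; last first.
  by case: ifP.
have vu : v != u.
  apply: contraTneq uv => ->.
  by have /andP[_ /forallP/(_ u)] := adjP G.
rewrite vu; have /andP[+ _] := wb u v; rewrite uv.
move: xu xv; rewrite -!ltNge /=; lra.
Qed.

Lemma card_heavy_le n (R : realType) (x : 'I_n -> R) :
  (forall u, 0 <= x u) -> #|heavy x|%:R <= trunc_dist x.
Proof.
move=> x0; rewrite -sum1_card natr_sum /trunc_dist mulr_sumr.
rewrite big_mkcond; apply: ler_sum => u _; rewrite inE.
by have := x0 u; case: ifPn => //=; lra.
Qed.

(** Setting x = 1 on the rewired nodes makes their constraints vacuous, so any
    solution for G' is repaired into one for G at the cost of one unit per
    rewired node. *)
Lemma lp_value_lipschitz n D (R : realType) (G G' : graph n)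
    (xw xw' : ('I_n -> R) * ('I_n -> 'I_n -> R)) :
  node_neighbors G G' -> lp_optimal D G xw -> lp_optimal D G' xw' ->
  \sum_(u < n) xw.1 u <= \sum_(u < n) xw'.1 u + 1.
Proof.
move=> /node_neighborsP[S S1 /forallP rS] [_ opt] [feas' _].
case: xw' feas' => /= x w [x0 wsym w0 wb wD].
pose x1 u := if u \in S then 1 else x u.
pose w1 u v := if (u \in S) || (v \in S) then 0 else w u v.
have x10 u : 0 <= x1 u by rewrite /x1; case: ifP.
apply: (@le_trans _ _ (\sum_u x1 u)).
  apply: (opt x1 w1); split=> //.
  - by move=> u v; rewrite /w1 orbC wsym.
  - by move=> u v; rewrite /w1; case: ifP.
  - move=> u v; rewrite /w1; case: ifPn => [uvS|/norP[uS vS]].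
      rewrite ler0n andbT.
      have a1 : (adj G u v)%:R <= 1 :> R by rewrite (ler_nat _ _ 1) leq_b1.
      have := x10 u; have := x10 v.
      by case/orP: uvS => iS; rewrite /x1 iS; lra.
    have /forallP/(_ v) := rS u; rewrite uS vS /= => /eqP ->.
    by rewrite /x1 (negbTE uS) (negbTE vS).
  - move=> u; apply: le_trans (wD u); apply: ler_sum => v _.
    by rewrite /w1; case: ifP.
apply: (@le_trans _ _ (\sum_u (x u + (u \in S)%:R))).
  apply: ler_sum => u _; rewrite /x1; have := x0 u.
  by case: ifP => _ /=; lra.
rewrite big_split /= lerD2l -natr_sum.
have -> : (\sum_(u < n) (u \in S) = #|S|)%N.
  by rewrite -sum1_card [RHS]big_mkcond; apply: eq_bigr => u _; case: ifP.
by rewrite (ler_nat _ _ 1).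
Qed.

Lemma trunc_dist_lipschitz n D (R : realType) (G G' : graph n)
    (xw xw' : ('I_n -> R) * ('I_n -> 'I_n -> R)) :
  node_neighbors G G' -> lp_optimal D G xw -> lp_optimal D G' xw' ->
  `|trunc_dist xw.1 - trunc_dist xw'.1| <= 4.
Proof.
move=> GG' opt opt'; rewrite /trunc_dist ler_norml.
have := lp_value_lipschitz GG' opt opt'.
have := lp_value_lipschitz (node_neighbors_sym GG') opt' opt.
lra.
Qed.

(** The length is at most 1 + trunc_dist x + trunc_dist x', where x and x' are
    the solutions for G and G'; trading x' for x costs 4, hence the constant 5. *)
Lemma truncation_rewiring_path n D (R : realType) (G G' : graph n)
    (xw xw' : ('I_n -> R) * ('I_n -> 'I_n -> R)) :
  node_neighbors G G' -> lp_optimal D G xw -> lp_optimal D G' xw' ->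
  exists2 k, k%:R <= 5 + 2 * trunc_dist xw.1 &
    rewiring_path (fun H => (max_degree H <= 2 * D)%N) k
      (truncate xw.1 G) (truncate xw'.1 G').
Proof.
move=> GG' opt opt'; have [feas _] := opt; have [feas' _] := opt'.
exists (#|heavy xw'.1| + (#|heavy xw.1| + 1))%N.
  have [x0 _ _ _ _] := feas; have [x0' _ _ _ _] := feas'.
  have := card_heavy_le x0; have := card_heavy_le x0'.
  have := trunc_dist_lipschitz GG' opt opt'.
  rewrite ler_norml !natrD; lra.
rewrite !truncate_prune; apply: pruned_neighbors_rewiring_path GG' _ _;
  rewrite -truncate_prune.
- exact: max_degree_truncate feas.
- exact: max_degree_truncate feas'.
Qed.

(** * Group privacy *)

Lemma group_privacy n (Q : graph n -> Prop) (R : realType)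
    (d : measure_display) (Omega : measurableType d) (P : probability Omega R)
    (d' : measure_display) (T : measurableType d')
    (M : graph n -> Omega -> T) (e : R) k (G H : graph n) (S : set T) :
  node_DP_on Q P M e 0 -> rewiring_path Q k G H -> measurable S ->
  (P (M G @^-1` S) <= (expR (k%:R * e))%:E * P (M H @^-1` S))%E.
Proof.
move=> DP; elim=> {k G H} [G|k G K H QG QK GK _ IH] mS.
  by rewrite mul0r expR0 mul1e.
apply: le_trans (DP _ _ QG QK GK _ mS) _; rewrite adde0.
rewrite -natr1 mulrDl mul1r addrC expRD EFinM -muleA.
by apply: lee_wpmul2l; [rewrite lee_fin expR_ge0|exact: IH].
Qed.

(** * The Laplace law *)

Lemma lebesgue_integral_shift (R : realType) (a : R) (B : set R)
    (f : R -> \bar R) :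
  measurable B -> measurable_fun setT f -> (forall t, (0 <= f t)%E) ->
  (\int[lebesgue_measure]_(t in B) f t =
   \int[lebesgue_measure]_(t in [set t | B (t + a)%R]) f (t + a)%R)%E.
Proof.
move=> mB mf f0.
have mshift : @measurable_fun _ _ (measurableTypeR R) (measurableTypeR R)
    setT (fun t => t + a).
  exact: measurable_funD.
rewrite -(@ge0_integral_pushforward _ _ _ _ _ _ mshift lebesgue_measure B f)//.
- apply: eq_measure_integral => C mC _.
  apply: lebesgue_measure_unique => // _ [[x y] _ <-].
  rewrite -[RHS]/(lebesgue_measure ((fun t : R => t + a) @^-1` `]x, y])).
  have -> : (fun t : R => t + a) @^-1` `]x, y] = `](x - a), (y - a)]%classic.
    by apply/seteqP; split => t /=; rewrite !in_itv /= ltrBlDr lerBrDr.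
  rewrite !lebesgue_measure_itv /= !lte_fin ltrD2r.
  by case: ifP => // _; rewrite -!EFinD; congr EFin; lra.
- exact: measurable_funTS.
Qed.

Lemma measurable_laplace_pdf (R : realType) (b : R) :
  measurable_fun setT (laplace_pdf b).
Proof.
apply: measurable_funM => //; apply: measurableT_comp => //.
by apply: measurableT_comp => //; apply: measurable_funM => //.
Qed.

Lemma laplace_pdf_ge0 (R : realType) (b t : R) : 0 < b -> 0 <= laplace_pdf b t.
Proof. by move=> b0; rewrite divr_ge0 ?expR_ge0// mulr_ge0// ltW. Qed.

Section Laplace.
Context {R : realType} {d : measure_display} {Omega : measurableType d}.
Variables (P : probability Omega R) (Z : {RV P >-> R}) (b : R).
Hypotheses (b_gt0 : 0 < b) (Z_laplace : has_laplace_law Z b).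

(** A pointwise comparison of the density with its translate passes to the law,
    by translation invariance of the Lebesgue measure.  Both the shift bound and
    the tail bound below are instances. *)
Lemma laplace_shift_le (a c : R) (B : set R) : measurable B -> 0 <= c ->
  (forall t, B (t + a) -> laplace_pdf b t <= c * laplace_pdf b (t + a)) ->
  (distribution P Z [set t | B (t + a)%R] <= c%:E * distribution P Z B)%E.
Proof.
move=> mB c0 le_pdf.
have mshift : measurable_fun [set: R] (fun t : R => t + a).
  exact: measurable_funD.
have mBa : measurable [set t | B (t + a)].
  by rewrite -[X in measurable X]setTI; exact: mshift.
have mpdf := measurable_laplace_pdf b.
rewrite !Z_laplace// (@lebesgue_integral_shift _ a B)//; last 2 first.
- exact/measurable_EFinP.
- by move=> t; rewrite lee_fin laplace_pdf_ge0.
rewrite -ge0_integralZl//.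
- apply: ge0_le_integral => //.
  + by move=> t _; rewrite lee_fin laplace_pdf_ge0.
  + by apply/measurable_EFinP/measurable_funTS.
  + apply/measurable_EFinP/measurable_funTS; apply: measurable_funM => //.
    exact: measurableT_comp.
- by apply/measurable_EFinP/measurable_funTS; exact: measurableT_comp.
- by move=> t _; rewrite lee_fin laplace_pdf_ge0.
Qed.

(** The exponent of the density is 1/b-Lipschitz, by the triangle inequality. *)
Lemma laplace_law_shift (a : R) (B : set R) : measurable B ->
  (distribution P Z [set t | B (t + a)%R] <=
   (expR (`|a| / b))%:E * distribution P Z B)%E.
Proof.
move=> mB; apply: laplace_shift_le => // t _.
rewrite /laplace_pdf [leRHS]mulrA -expRD ler_pM2r ?invr_gt0 ?mulr_gt0//.
by rewrite ler_expR -mulrBl ler_pdivlMr// -mulNr divfK ?gt_eqF//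
  lerBrDr addrC lerBlDr addrC ler_normD.
Qed.

(** On the negative half-line, translating the density by b * c multiplies it by
    exactly exp(c).  The tail is thus exp(-c) times the mass of the half-line,
    and bounding that mass by 1 avoids evaluating any integral. *)
Lemma laplace_lower_tail (c : R) : 0 <= c ->
  (distribution P Z [set t | (t < - (b * c))%R] <= (expR (- c))%:E)%E.
Proof.
move=> c0.
have -> : [set t | t < - (b * c)] = [set t | `]-oo, 0[%classic (t + b * c)].
  by apply/seteqP; split => t /=; rewrite in_itv /= -ltrBrDr sub0r.
apply: (@le_trans _ _ ((expR (- c))%:E * distribution P Z `]-oo, 0%R[%classic)%E).
  apply: laplace_shift_le => // t.
  rewrite /= in_itv /= => tc; have bc0 : 0 <= b * c by rewrite mulr_ge0// ltW.
  rewrite /laplace_pdf [leRHS]mulrA -expRD ler_pM2r ?invr_gt0 ?mulr_gt0//.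
  rewrite ler_expR !ltr0_norm//; last by lra.
  by rewrite !mulNr !opprK mulrDl mulrAC divff ?gt_eqF// mul1r; lra.
rewrite -[leRHS]mule1; apply: lee_wpmul2l; first by rewrite lee_fin expR_ge0.
exact: probability_le1.
Qed.

(** Here the translation acts on the argument of the integrand: this compares
    the expectations of one function of two statistics that add the same noise
    to different centres. *)
Lemma laplace_expectation_shift (a : R) (f : R -> \bar R) :
  measurable_fun setT f -> (forall t, (0 <= f t)%E) ->
  (\int[distribution P Z]_t f (t + a)%R <=
   (expR (`|a| / b))%:E * \int[distribution P Z]_t f t)%E.
Proof.
move=> mf f0.
have mshift : measurable_fun [set: R] (fun t : R => t + a).
  exact: measurable_funD.
rewrite -(@ge0_integral_pushforward _ _ _ _ _ _ mshift
  (distribution P Z) setT f)//.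
have c0 := expR_ge0 (`|a| / b).
rewrite -(@ge0_integral_mscale _ _ _ _ _ _ (NngNum c0))//.
apply: ge0_le_measure_integral => // B mB.
exact: laplace_law_shift.
Qed.

End Laplace.

(** * Combining the noise and the seed *)

(** Independence says that the joint law agrees with the product measure on
    rectangles, and this determines it. *)
Lemma independent_joint_law (R : realType) (d : measure_display)
    (Omega : measurableType d) (P : probability Omega R)
    (d1 d2 : measure_display) (T1 : measurableType d1) (T2 : measurableType d2)
    (X : {RV P >-> T1}) (Y : {RV P >-> T2}) (E : set (T1 * T2)) :
  independent_RVs X Y -> measurable E ->
  (P [set omega | E (X omega, Y omega)] =
   \int[distribution P X]_t distribution P Y (xsection E t))%E.
Proof.
move=> XY mE.
have mXY : measurable_fun setT (fun omega => (X omega, Y omega)).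
  exact: measurable_fun_pair.
pose mXY_ := isMeasurableFun.Build _ _ _ _ _ mXY.
pose XY_ : {mfun _ >-> _} :=
  HB.pack (fun omega => (X omega, Y omega)) mXY_.
rewrite -[LHS]/(distribution P XY_ E).
have <- // := @product_measure_unique _ _ _ _ _ (distribution P X)
  (distribution P Y) (distribution P XY_).
Qed.

Lemma measurable_adaptive_output (R : realType)
    (dU : measure_display) (Seed : measurableType dU)
    (dY : measure_display) (Y : measurableType dY)
    (A : R -> Seed -> Y) (eps : R) (l : R -> R) :
  measurable_fun ([set e : R | 0 < e] `*` [set: Seed])
    (fun p : R * Seed => A p.1 p.2) ->
  0 < eps -> measurable_fun [set: R] l -> (forall t, 0 < l t) ->
  measurable_fun [set: R * Seed]
    (fun p : R * Seed => (l p.1, A (eps / l p.1) p.2)).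
Proof.
move=> mA eps0 ml l0.
have ml1 : measurable_fun [set: R * Seed] (fun p : R * Seed => l p.1).
  exact: measurableT_comp ml measurable_fst.
apply: measurable_fun_pair => //.
apply: (@measurable_comp _ _ _ _ _ _ ([set e : R | 0 < e] `*` [set: Seed])
  (fun p : R * Seed => A p.1 p.2) setT
  (fun p : R * Seed => (eps / l p.1, p.2))) => //.
- by apply: measurableX => //; rewrite -set_itvoy.
- by move=> _ [p _ <-]; split => //=; exact: divr_gt0.
- apply: measurable_fun_pair; last exact: measurable_snd.
  (* On positive reals, inversion is the power with exponent -1. *)
  apply: (@eq_measurable_fun _ _ _ _ _ (fun p => eps * (l p.1) `^ (-1))).
    by move=> p _; rewrite powR_inv1// ltW.
  apply: measurable_funM => //.
  exact: (measurableT_comp (measurable_powR (-1)) ml1).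
Qed.

Lemma measurable_L_hat n (R : realType) (eps delta : R) (x : 'I_n -> R) :
  measurable_fun [set: R] (L_hat eps delta x).
Proof.
apply: measurable_maxr => //; apply: measurable_funD => //.
exact: measurable_funD.
Qed.

Lemma L_hat_gt0 n (R : realType) (eps delta : R) (x : 'I_n -> R) (z : R) :
  0 < L_hat eps delta x z.
Proof. by rewrite /L_hat lt_max invr_gt0 ltr0n. Qed.

(** The input enters [L_hat] only through an additive shift of the noise. *)
Lemma L_hat_shift n (R : realType) (eps delta : R) (x x' : 'I_n -> R) (z : R) :
  L_hat eps delta x z =
  L_hat eps delta x' (z + 2 * (trunc_dist x - trunc_dist x')).
Proof. by rewrite /L_hat; congr Num.max; lra. Qed.

(** The term 8 * ln (1 / delta) / eps absorbs the negative part of the noise,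
    outside an event of probability at most delta. *)
Lemma L_hat_ge n (R : realType) (eps delta : R) (x : 'I_n -> R) (z : R) :
  - (8 / eps * ln delta^-1) <= z ->
  5 + 2 * trunc_dist x <= L_hat eps delta x z.
Proof. by rewrite mulrAC => ze; rewrite /L_hat le_max; apply/orP; right; lra. Qed.

(** * Privacy of the pair *)

(* sol is the deterministic rule selecting an optimal LP solution; U is the
   internal randomness of the algorithms and A e G u the output of the
   algorithm with parameter e on input G when the internal randomness is u.
   Joint measurability of A in (e, u) makes the composed algorithm a
   well-defined random element. *)
Theorem theorem3 (R : realType) (n D : nat)
    (sol : graph n -> ('I_n -> R) * ('I_n -> 'I_n -> R))
    (sol_opt : forall G : graph n, lp_optimal D G (sol G))
    (eps1 eps2 delta1 : R)
    (eps1_gt0 : 0 < eps1) (eps2_gt0 : 0 < eps2)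
    (delta1_gt0 : 0 < delta1) (delta1_lt1 : delta1 < 1)
    (d : measure_display) (Omega : measurableType d) (P : probability Omega R)
    (dU : measure_display) (Seed : measurableType dU) (U : {RV P >-> Seed})
    (dY : measure_display) (Y : measurableType dY)
    (A : R -> graph n -> Seed -> Y)
    (A_meas : forall G : graph n,
       measurable_fun ([set e : R | 0 < e] `*` [set: Seed])
         (fun p : R * Seed => A p.1 G p.2))
    (A_DP : forall e : R, 0 < e ->
       node_DP_2D D P (fun G omega => A e G (U omega)) e 0)
    (Z : {RV P >-> R})
    (Z_laplace : has_laplace_law Z (8 / eps1))
    (ZU_indep : independent_RVs Z U) :
  node_DP P
    (fun (G : graph n) (omega : Omega) =>
       let L := L_hat eps1 delta1 (sol G).1 (Z omega) in
       (L, A (eps2 / L) (truncate (sol G).1 G) (U omega)))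
    (eps1 + eps2) (expR eps1 * delta1).
Proof.
move=> G G' _ _ GG' S mS.
have optG := sol_opt G; have optG' := sol_opt G'.
set L : graph n -> R -> R := fun H => L_hat eps1 delta1 (sol H).1.
set T : graph n -> graph n := fun H => truncate (sol H).1 H.
(* K provides the estimate L and H the graph that is processed; comparing
   (G, G) with (G', G') goes through the mixed pair (G, G'). *)
pose out K H (p : R * Seed) := (L K p.1, A (eps2 / L K p.1) (T H) p.2).
pose E K H := out K H @^-1` S.
have mE K H : measurable (E K H).
  have mout := measurable_adaptive_output (A := fun e u => A e (T H) u)
    (A_meas (T H)) eps2_gt0 (measurable_L_hat eps1 delta1 (sol K).1)
    (L_hat_gt0 eps1 delta1 (sol K).1).
  by rewrite -[X in measurable X]setTI; exact: mout.
(* The conditional probability of S given that the noise is t. *)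
pose h K H t := distribution P U (xsection (E K H) t).
have mh K H : measurable_fun setT (h K H) by exact: measurable_fun_xsection.
have h0 K H t : (0 <= h K H t)%E by exact: measure_ge0.
have law H : (P ((fun omega => out H H (Z omega, U omega)) @^-1` S) = \int[distribution P Z]_t h H H t)%E.
  exact: (independent_joint_law ZU_indep (mE H H)).
rewrite [leLHS]law [in leRHS]law.
set b := 8 / eps1.
have b0 : 0 < b by exact: divr_gt0.
pose bad : set R := [set t | t < - (b * ln delta1^-1)].
have mbad : measurable bad by rewrite /bad -set_itvNyo.
have pointwise t : (h G G t <= (\1_bad t)%:E + (expR eps2)%:E * h G G' t)%E.
  (* On the bad event only the trivial bound 1 is available. *)
  have [tb|tg] := ltP t (- (b * ln delta1^-1)).
    rewrite indicE mem_set// -[leLHS]adde0; apply: leeD.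
      by apply: probability_le1; exact: measurable_xsection.
    by rewrite mule_ge0// lee_fin expR_ge0.
  rewrite indicE memNset ?add0e; last by apply/negP; rewrite -leNgt.
  have [k kd path_k] := truncation_rewiring_path GG' optG optG'.
  have Lt0 : 0 < L G t by exact: L_hat_gt0.
  have kL : k%:R <= L G t by exact: le_trans kd (L_hat_ge _ tg).
  have mSt := measurable_xsection (L G t) mS.
  have e0 : 0 < eps2 / L G t by exact: divr_gt0.
  have hE H : h G H t =
      P ((fun omega => A (eps2 / L G t) (T H) (U omega)) @^-1` xsection S (L G t)).
    by rewrite /h /distribution /pushforward; congr (P _).
  (* k steps at eps2 / L each cost at most eps2, as k <= L. *)
  rewrite !hE; apply: le_trans (group_privacy (A_DP _ e0) path_k mSt) _.
  apply: lee_wpmul2r; first exact: measure_ge0.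
  rewrite lee_fin ler_expR mulrCA ger_pMr// ler_pdivrMr// mul1r//.
apply: (@le_trans _ _ (\int[distribution P Z]_t
  ((\1_bad t)%:E + (expR eps2)%:E * h G G' t))%E).
  apply: ge0_le_integral => //.
  apply: emeasurable_funD; first by apply/measurable_EFinP; exact: measurable_indic.
  exact: measurable_funeM.
rewrite ge0_integralD//; last 3 first.
- by apply/measurable_EFinP; exact: measurable_indic.
- by move=> t _; rewrite mule_ge0// lee_fin expR_ge0.
- exact: measurable_funeM.
rewrite integral_indic// setIT ge0_integralZl//.
rewrite addeC; apply: leeD.
  (* Replace the centre of the noise for G by the centre for G'. *)
  rewrite [in leRHS]addrC expRD EFinM -muleA; apply: lee_wpmul2l.
    by rewrite lee_fin expR_ge0.
  pose a := 2 * (trunc_dist (sol G).1 - trunc_dist (sol G').1).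
  have hshift t : h G G' t = h G' G' (t + a).
    by rewrite /h !xsectionE /E /out /preimage /= /L (L_hat_shift _ _ _ (sol G').1).
  under eq_integral do rewrite hshift.
  apply: le_trans (laplace_expectation_shift b0 Z_laplace a (mh G' G') (h0 G' G')) _.
  apply: lee_wpmul2r; first by apply: integral_ge0 => t _; exact: h0.
  rewrite lee_fin ler_expR ler_pdivrMr// /b mulrCA mulfV ?gt_eqF// mulr1.
  have := trunc_dist_lipschitz GG' optG optG'.
  by rewrite /a normrM ger0_norm//; lra.
have ld : 0 <= ln delta1^-1 by rewrite ln_ge0// invf_ge1// ltW.
apply: le_trans (laplace_lower_tail b0 Z_laplace ld) _.
rewrite lee_fin -lnV ?posrE ?invr_gt0// invrK lnK ?posrE//.
by rewrite ler_peMl ?ltW// -expR0 ltr_expR.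
Qed.
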